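(* Every locally compact, second countable group $G$ has a plig metric $d$.
   Context: Topological groups are assumed Hausdorff; $G$ is locally compact if every point has a relatively compact neighbourhood. A plig metric on a topological group $G$ is a metric $d$ on $G$ which is: proper (all closed $d$-bounded subsets of $G$ are compact), left invariant ($d(gx,gy)=d(x,y)$ for all $g,x,y\in G$), and generates the given topology of $G$ (the metric topology of $d$ coincides with the topology of $G$). *)

(* Defs.v *)
From HB Require Import structures.
From mathcomp Require Import all_boot all_order all_algebra.
From mathcomp Require Import all_classical all_reals topology.

Set Implicit Arguments.
Unset Strict Implicit.
Unset Printing Implicit Defensive.

Import Order.TTheory GRing.Theory Num.Theory.

Local Open Scope classical_set_scope.
Local Open Scope ring_scope.

HB.mixin Record isTopologicalGroup G & Topological G & Group G := {
  mulg_continuous : continuous (fun z : G * G => (z.1 * z.2)%g) ;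
  invg_continuous : continuous (fun x : G => (x^-1)%g) ;
}.

(* The Hausdorff property is not part of the structure; it is a separate
   hypothesis, [hausdorff_space]. *)
#[short(type="topologicalGroupType")]
HB.structure Definition TopologicalGroup :=
  {G of Topological G & Group G & isTopologicalGroup G}.

Record is_metric (R : numFieldType) (T : Type) (d : T -> T -> R) : Prop := {
  is_metric_xx : forall x, d x x = 0 ;
  is_metric_positivity : forall x y, d x y = 0 -> x = y ;
  is_metric_sym : forall x y, d x y = d y x ;
  is_metric_triangle : forall y x z, d x z <= d x y + d y z
}.

(* A copy of [T] that forgets any topology on [T] and carries the library's
   metric space structure (in particular the metric topology) given by [d]. *)
Definition metrized (R : numFieldType) (T : choiceType) (d : T -> T -> R)
  (dm : is_metric d) : Type := T.

Section metrized_instances.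
Context (R : numFieldType) (T : choiceType) (d : T -> T -> R).
Variable dm : is_metric d.

HB.instance Definition _ := Choice.copy (metrized dm) T.
HB.instance Definition _ := @isMetric.Build R (metrized dm) d
  (is_metric_xx dm) (is_metric_positivity dm)
  (is_metric_sym dm) (is_metric_triangle dm).
End metrized_instances.

Definition dbounded (R : numFieldType) (T : Type) (d : T -> T -> R)
    (A : set T) : Prop :=
  exists r : R, forall x y, A x -> A y -> d x y <= r.

Record plig_metric (R : realType) (G : topologicalGroupType)
    (d : G -> G -> R) : Prop := {
  plig_is_metric : is_metric d ;
  plig_proper : forall A : set G, closed A -> dbounded d A -> compact A ;
  plig_left_invariant : forall g x y : G, d (g * x)%g (g * y)%g = d x y ;
  plig_generates : forall U : set G,
    open U <-> open (U : set (metrized plig_is_metric))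
}.

(* Main.v *)
Require Import Defs.
From mathcomp Require Import all_boot all_order all_algebra.
From mathcomp Require Import all_classical all_reals topology.
From mathcomp Require Import zify lra.

(** This is Struble's theorem. The proof runs the Birkhoff-Kakutani
metrization over a family of neighbourhoods [U n] of the identity indexed by
all integers, where [U n] plays the role of the ball of radius [2 ^ n]: the
sets with [n] negative shrink to a base at the identity and encode the
topology, while those with [n] nonnegative are compact, exhaust the group and
encode properness.

Call [U] a scale if every [U n] contains 1, is symmetric, and satisfies
[U n * U n * U n] inside [U (n + 1)]. The length of [g] is the infimum of
[2 ^ n1 + ... + 2 ^ nk] over all ways of placing [g] in a product
[U n1 * ... * U nk]. Concatenating and reversing products makes it subadditive
and symmetric, so the distance from [x] to [y] defined as the length of
[x^-1 * y] is a left invariant pseudometric. The length is at most [2 ^ n] on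
[U n]. Conversely, and this is the heart of the matter ([word_light]), a
product of total weight below [2 ^ m] stays inside [U m]: it can be cut as a
prefix, one factor and a suffix, where prefix and suffix weigh less than
[2 ^ (m - 1)] and lie in [U (m - 1)] by induction; the single factor, being
some [U n] of weight below [2 ^ m], has [n <= m - 1] and lies there too. Hence
the open ball of radius [2 ^ n] around 1 is contained in [U n], and [U n] in the
closed one. If the [U n] form a base at 1 the metric therefore generates the
topology, and if each [U n] lies in a compact set, a closed bounded set is a
closed subset of a translate of a compact set.

A scale of this kind is obtained in both directions from a compact symmetric
neighbourhood [U 0] ([compact_scale_exists]). Upwards, the cube of [U n] is
compact, and a further compact set is added at each step; second countability
and local compactness provide countably many compact sets covering the group.
Downwards, continuity of [(x, y, z) |-> x * y * z] at the identity gives a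
symmetric neighbourhood [U (n - 1)] whose cube lies in [U n] and, from the
second step on, also in the next member of a countable base at 1. *)

Set Implicit Arguments.
Unset Strict Implicit.
Unset Printing Implicit Defensive.

Import Order.TTheory GRing.Theory Num.Theory.
Local Open Scope classical_set_scope.
Local Open Scope ring_scope.

(** * Integer powers of two *)

Lemma exp2z_gt0 (R : realFieldType) (n : int) : 0 < 2 ^ n :> R.
Proof. by apply: exprz_gt0. Qed.

Lemma exp2z_double (R : realFieldType) (n : int) :
  2 ^ (n + 1) = 2 ^ n + 2 ^ n :> R.
Proof. by rewrite expfzDr ?pnatr_eq0// expr1z mulr_natr mulr2n. Qed.

Lemma exp2z_unbounded (R : archiRealFieldType) (r : R) :
  exists n : int, r < 2 ^ n.
Proof.
exists (Posz (Num.trunc r).+1); apply: lt_trans (truncnS_gt r) _.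
by rewrite -exprnP -natrX ltr_nat ltn_expl.
Qed.

Lemma exp2z_small (R : archiRealFieldType) (e : R) :
  0 < e -> exists n : int, 2 ^ n < e.
Proof.
move=> e0; have [n] := exp2z_unbounded e^-1; exists (- n).
by rewrite -invr_expz invf_plt ?posrE ?exp2z_gt0.
Qed.

(** * The length function of a scale *)

(** The cube in [scaleM3], rather than the square, leaves room for the isolated
middle factor in [word_light]. *)
Record scale (G : groupType) (U : int -> set G) : Prop := {
  scale1 : forall n, U n 1%g ;
  scaleV : forall n x, U n x -> U n (x^-1)%g ;
  scaleM3 : forall n x y z, U n x -> U n y -> U n z -> U (n + 1) (x * y * z)%g
}.

Lemma scale_mono (G : groupType) (U : int -> set G) (m n : int) :
  scale U -> m <= n -> U m `<=` U n.
Proof.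
move=> sU; rewrite -subr_ge0 => mn x Ux.
have -> : n = m + `|n - m|%N%:Z by lia.
elim: `|n - m|%N => [|k IH]; first by rewrite addr0.
rewrite -addn1 PoszD addrA -[x]mulg1 -[x]mulg1.
by apply: scaleM3 => //; apply: scale1.
Qed.

Fixpoint word (G : groupType) (U : int -> set G) (s : seq int) : set G :=
  if s is n :: t then [set (x * y)%g | x in U n & y in word U t]
  else [set 1%g].

Definition weight (R : realType) (s : seq int) : R := \sum_(n <- s) 2 ^ n.

Lemma weight_cons (R : realType) n s : weight R (n :: s) = 2 ^ n + weight R s.
Proof. exact: big_cons. Qed.

Lemma weight_cat (R : realType) s t :
  weight R (s ++ t) = weight R s + weight R t.
Proof. exact: big_cat. Qed.

Lemma weight_ge0 (R : realType) s : 0 <= weight R s.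
Proof. by apply: sumr_ge0 => n _; apply/ltW/exp2z_gt0. Qed.

Section Words.
Variables (G : groupType) (U : int -> set G).

Lemma word_cat s t x y :
  word U s x -> word U t y -> word U (s ++ t) (x * y)%g.
Proof.
elim: s x => [x -> wy|n s IH x [a Ua [b wb <-]] wy]; first by rewrite mul1g.
by exists a => //; exists (b * y)%g; [apply: IH|rewrite mulgA].
Qed.

Lemma word_catP s t x :
  word U (s ++ t) x -> exists y z, [/\ word U s y, word U t z & x = (y * z)%g].
Proof.
elim: s x => [x wx|n s IH x [a Ua [b /IH[y [z [wy wz ->]]] <-]]].
  by exists 1%g, x; rewrite mul1g.
by exists (a * y)%g, z; split; [exists a => //; exists y|by []|rewrite mulgA].
Qed.

Lemma word_rev s x : scale U -> word U s x -> word U (rev s) (x^-1)%g.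
Proof.
move=> sU; elim: s x => [x ->|n s IH x [a Ua [b wb <-]]].
  by rewrite invg1.
rewrite rev_cons -cats1 invgM; apply: word_cat; first exact: IH.
by exists (a^-1)%g; [apply: scaleV|exists 1%g => //; rewrite mulg1].
Qed.

End Words.

Lemma weight_rev (R : realType) s : weight R (rev s) = weight R s.
Proof. by rewrite /weight (perm_big s)// perm_rev. Qed.

(** Take for [s1] the shortest prefix such that what follows the next letter
weighs less than [b]. If [s1] is not empty, its being the shortest means that
everything after it weighs at least [b], so [s1] weighs less than [a]. *)
Lemma weight_split (R : realType) (s : seq int) (a b : R) :
  0 < a -> 0 < b -> s != [::] -> weight R s < a + b ->
  exists s1 n s2,
    [/\ s = s1 ++ n :: s2, weight R s1 < a & weight R s2 < b].
Proof.
(* The induction on [s] lowers [a] by the weight of each letter put in [s1]. *)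
move=> + b0; elim: s a => // n s IH a a0 _; rewrite weight_cons => wab.
have [wb|bw] := ltP (weight R s) b.
  by exists [::], n, s; rewrite /weight big_nil.
have s0 : s != [::].
  by apply: contraTneq bw => ->; rewrite /weight big_nil -ltNge.
have a'0 : 0 < a - 2 ^ n by lra.
have wa' : weight R s < a - 2 ^ n + b by lra.
have [s1 [m [s2 [-> w1 w2]]]] := IH _ a'0 s0 wa'.
by exists (n :: s1), m, s2; split => //; rewrite weight_cons; lra.
Qed.

(** This makes the length function comparable with the scale. Cutting with
[weight_split] at [2 ^ m = 2 ^ (m - 1) + 2 ^ (m - 1)] gives two shorter words
to which induction on the length applies, and a middle letter [n] that is
smaller than [m] because its own weight is below [2 ^ m]. The three factors are
then in [U (m - 1)], and their product in [U m]. *)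
Lemma word_light (R : realType) (G : groupType) (U : int -> set G)
    (s : seq int) (m : int) :
  scale U -> weight R s < 2 ^ m -> word U s `<=` U m.
Proof.
move=> sU; have [k] := ubnP (size s); elim: k s m => // k IH s m sk sm g.
have [->/= ->|s0] := eqVneq s [::]; first exact: scale1.
have mE : m = (m - 1) + 1 by rewrite subrK.
move: sm; rewrite {1}mE exp2z_double => sm.
have [s1 [n [s2 [sE w1 w2]]]] :=
  weight_split (exp2z_gt0 R (m - 1)) (exp2z_gt0 R (m - 1)) s0 sm.
have nm : n <= m - 1.
  rewrite -ltzD1 -mE -(ltr_eXz2l (x := 2 : R)) ?ltr1n// mE exp2z_double.
  apply: le_lt_trans sm; rewrite sE weight_cat weight_cons.
  by have := weight_ge0 R s1; have := weight_ge0 R s2; lra.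
move: sk; rewrite sE size_cat/= => sk.
move=> /word_catP[x [_ [wx [y Uy [z wz <-]] ->]]].
rewrite mE mulgA; apply: scaleM3 => //.
- by apply: (IH s1) => //; lia.
- exact: scale_mono Uy.
- by apply: (IH s2) => //; lia.
Qed.

Definition scale_length (R : realType) (G : groupType) (U : int -> set G)
  (g : G) : R := inf (weight R @` [set s | word U s g]).

Section Length.
Variables (R : realType) (G : groupType) (U : int -> set G).
Hypothesis sU : scale U.
Hypothesis U_cover : forall g, exists n, U n g.
Local Notation len := (scale_length R U).

Lemma word_weights_has_inf g : has_inf (weight R @` [set s | word U s g]).
Proof.
split; last by exists 0 => _ [s _ <-]; apply: weight_ge0.
have [n Ung] := U_cover g; exists (weight R [:: n]); exists [:: n] => //.
by exists g => //; exists 1%g => //; rewrite mulg1.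
Qed.

Lemma scale_length_le s g : word U s g -> len g <= weight R s.
Proof.
by move=> ws; apply: ge_inf; [case: (word_weights_has_inf g)|exists s].
Qed.

Lemma scale_length_lt g r :
  len g < r -> exists2 s, word U s g & weight R s < r.
Proof.
case/inf_lt; first by case: (word_weights_has_inf g).
by move=> _ [s ws <-] wr; exists s.
Qed.

Lemma scale_length_ge0 g : 0 <= len g.
Proof.
apply: lb_le_inf; first by case: (word_weights_has_inf g).
by move=> _ [s _ <-]; apply: weight_ge0.
Qed.

Lemma scale_length1 : len 1%g = 0.
Proof.
apply/eqP; rewrite eq_le scale_length_ge0 andbT.
by have := @scale_length_le [::] 1%g erefl; rewrite /weight big_nil.
Qed.

Lemma scale_lengthV_le g : len (g^-1)%g <= len g.
Proof.
rewrite leNgt; apply/negP => /scale_length_lt[s ws].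
apply/negP; rewrite -leNgt -weight_rev; apply: scale_length_le.
exact: word_rev.
Qed.

Lemma scale_lengthV g : len (g^-1)%g = len g.
Proof.
by apply/eqP; rewrite eq_le scale_lengthV_le -{1}[g]invgK scale_lengthV_le.
Qed.

Lemma scale_lengthM g h : len (g * h)%g <= len g + len h.
Proof.
apply/ler_addgt0Pr => e e0.
have [|s ws se] := @scale_length_lt g (len g + e / 2); first by lra.
have [|t wt te] := @scale_length_lt h (len h + e / 2); first by lra.
have := scale_length_le (word_cat ws wt); rewrite weight_cat; lra.
Qed.

Lemma scale_length_le_exp2 n g : U n g -> len g <= 2 ^ n.
Proof.
move=> Ug; rewrite -[leRHS](_ : weight R [:: n] = _); last exact: big_seq1.
by apply: scale_length_le; exists g => //; exists 1%g => //; rewrite mulg1.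
Qed.

Lemma scale_length_lt_exp2 n g : len g < 2 ^ n -> U n g.
Proof. by move=> /scale_length_lt[s ws wn]; apply: word_light wn _ ws. Qed.

End Length.

(** * Neighbourhoods of the identity and compact sets in topological groups *)

Definition mul3 (G : groupType) (p : G * G * G) : G := (p.1.1 * p.1.2 * p.2)%g.

Definition cube (G : groupType) (A : set G) : set G :=
  @mul3 G @` (A `*` A `*` A).

Lemma sub_cube (G : groupType) (A : set G) : A 1%g -> A `<=` cube A.
Proof.
by move=> A1 x Ax; exists (1%g, 1%g, x) => //; rewrite /mul3/= !mul1g.
Qed.

Lemma setU_invV (G : groupType) (A : set G) x :
  (A `|` [set (x^-1)%g | x in A]) x ->
  (A `|` [set (x^-1)%g | x in A]) (x^-1)%g.
Proof. by case=> [Ax|[y Ay <-]]; [right; exists x|left; rewrite invgK]. Qed.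

Lemma cubeV (G : groupType) (A : set G) x :
  (forall y, A y -> A (y^-1)%g) -> cube A x -> cube A (x^-1)%g.
Proof.
move=> AV [[[a b] c]/= [[/= Aa Ab] Ac] <-].
exists ((c^-1)%g, (b^-1)%g, (a^-1)%g); first by split; [split|]; apply: AV.
by rewrite /mul3/= !invgM mulgA.
Qed.

Section TopologicalGroupFacts.
Variable G : topologicalGroupType.
Implicit Types (A B : set G) (g x y : G).

Lemma mulg2_continuous (T : topologicalType) (f h : T -> G) :
  continuous f -> continuous h -> continuous (fun t => (f t * h t)%g).
Proof.
move=> cf ch t.
apply: (@continuous_comp _ _ _ (fun t => (f t, h t))
  (fun z : G * G => (z.1 * z.2)%g)).
  by apply: cvg_pair; [apply: cf|apply: ch].
exact: mulg_continuous.
Qed.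

Lemma mul3_continuous : continuous (@mul3 G).
Proof.
have c1 : continuous (fun p : G * G * G => p.1) by move=> p; apply: cvg_fst.
have c2 : continuous (fun p : G * G * G => p.2) by move=> p; apply: cvg_snd.
apply: mulg2_continuous => //; apply: mulg2_continuous => p.
- by apply: (continuous_comp (c1 p)); apply: cvg_fst.
- by apply: (continuous_comp (c1 p)); apply: cvg_snd.
Qed.

Lemma lmulg_continuous g : continuous (fun x : G => (g * x)%g).
Proof. by apply: mulg2_continuous => x; [apply: cvg_cst|apply: cvg_id]. Qed.

Lemma compact_cube A : compact A -> compact (cube A).
Proof.
move=> cA; apply: continuous_compact.
  by apply: continuous_subspaceT; apply: mul3_continuous.
by do 2?apply: compact_setX.
Qed.

Lemma compact_inv A : compact A -> compact [set (x^-1)%g | x in A].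
Proof.
apply: continuous_compact.
by apply: continuous_subspaceT; apply: invg_continuous.
Qed.

Lemma compact_translate g A :
  compact A -> compact [set (g * x)%g | x in A].
Proof.
apply: continuous_compact.
by apply: continuous_subspaceT; apply: lmulg_continuous.
Qed.

Lemma nbhs_translate x A : nbhs (1%g : G) A -> nbhs x [set (x * y)%g | y in A].
Proof.
move=> nA; have : nbhs x [set z | A (x^-1 * z)%g].
  by apply: lmulg_continuous; rewrite mulVg.
apply: filterS => z Az.
by exists (x^-1 * z)%g => //; rewrite mulgA mulgV mul1g.
Qed.

Lemma nbhs_untranslate x A : nbhs x A -> nbhs (1%g : G) [set y | A (x * y)%g].
Proof. by move=> nA; apply: lmulg_continuous; rewrite mulg1. Qed.

(** Continuity of the triple product at [(1, 1, 1)] gives a box of three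
neighbourhoods; intersecting these with each other, and the result with its
image under inversion, makes them equal and symmetric. *)
Lemma nbhs_cube_root A : nbhs (1%g : G) A ->
  exists W, [/\ nbhs (1%g : G) W, forall x, W x -> W (x^-1)%g & cube W `<=` A].
Proof.
move=> nA; have := @mul3_continuous (1%g, 1%g, 1%g) A.
rewrite {1}/mul3/= !mulg1 => /(_ nA).
move=> [[P Q]/= [[[P1 P2]/= [nP1 nP2] P12 nQ] PQA]].
have nW : nbhs (1%g : G) (P1 `&` P2 `&` Q) by do 2?apply: filterI.
exists ((P1 `&` P2 `&` Q) `&` [set x | (P1 `&` P2 `&` Q) (x^-1)%g]); split.
- by apply: filterI => //; apply: invg_continuous; rewrite invg1.
- by move=> x [Wx WVx]; split; rewrite /= ?invgK.
- move=> _ [[[x y] z]/= [[[[[? ?] ?] _] [[[? ?] ?] _]] [[[? ?] ?] _]] <-].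
  by apply: PQA; split => //=; apply: P12.
Qed.

End TopologicalGroupFacts.

(** * Countable data *)

Lemma countable_base_sequence (T : topologicalType) (x0 : T) :
  @second_countable T ->
  exists B : nat -> set T,
    forall (x : T) A, nbhs x A -> exists n, nbhs x (B n) /\ B n `<=` A.
Proof.
move=> [B0 cB0 [B0open B0basis]].
have [V [B0V _] _] := B0basis x0 setT filterT.
case/pfcard_geP: cB0 => [B00|/unsquash f]; first by rewrite B00 in B0V.
exists f => x A /B0basis[W [B0W Wx] WA].
have [n _ fn] := 'surj_f B0W; exists n; rewrite fn; split => //.
by apply: open_nbhs_nbhs; split => //; apply: B0open.
Qed.

(** Each point has a compact neighbourhood, which contains some member [B n] of
the base around that point; so it is enough to choose, for every [n] such that
[B n] lies in a compact set, one compact set containing it. *)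
Lemma compact_sequence_cover (T : topologicalType) (B : nat -> set T) :
  locally_compact [set: T] ->
  (forall (x : T) A, nbhs x A -> exists n, nbhs x (B n) /\ B n `<=` A) ->
  exists K : nat -> set T,
    (forall n, compact (K n)) /\ forall x : T, exists n, nbhs x (K n).
Proof.
move=> lcT Bbase.
have /choice[K KP] : forall n, exists K, compact K /\
    forall C, compact C -> B n `<=` C -> B n `<=` K.
  move=> n.
  have [[C [cC BC]]|nC] := pselect (exists C, compact C /\ B n `<=` C).
    by exists C.
  exists set0; split; first exact: compact0.
  by move=> C cC BC; case: nC; exists C.
exists K; split => [n|x]; first by case: (KP n).
have [C] := lcT x I.
rewrite withinET => nC [cC _]; have [n [nB BC]] := Bbase _ _ nC.
by exists n; apply: filterS nB; exact: (KP n).2 cC BC.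
Qed.

Lemma nbhs_base_sequence (T : topologicalType) (x : T) :
  @second_countable T ->
  exists N : nat -> set T,
    (forall n, nbhs x (N n)) /\ forall A, nbhs x A -> exists n, N n `<=` A.
Proof.
move=> /(countable_base_sequence x)[B Bbase].
(* Members of the base that are not neighbourhoods of [x] are replaced by the
   whole space. *)
exists (fun n => if `[< nbhs x (B n) >] then B n else setT); split=> [n|A nA].
  by case: asboolP => // _; apply: filterT.
by have [n [nB BA]] := Bbase x A nA; exists n; case: asboolP.
Qed.

(** * Existence of a scale of compact neighbourhoods *)

Section Existence.
Variables (G : topologicalGroupType) (C : set G) (K : nat -> set G).
Variables (root : set G -> set G) (N : nat -> set G).

(** The nonnegative part of the scale; adding [K m] and its inverse at step [m]
is what makes the sets cover the group once the [K m] do. *)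
Fixpoint large_scale n : set G :=
  if n is m.+1 then
    cube (large_scale m) `|` (K m `|` [set (x^-1)%g | x in K m])
  else C `|` [set (x^-1)%g | x in C].

(** The negative part of the scale, where [small_scale n] is the set of index
[- (n + 1)] and [root] stands for a choice of cube roots of neighbourhoods of
the identity; intersecting with [N m] is what makes it a base at 1 if the [N m]
form one. *)
Fixpoint small_scale n : set G :=
  if n is m.+1 then root (small_scale m `&` N m) else root (large_scale 0).

Definition full_scale (n : int) : set G :=
  match n with Posz n => large_scale n | Negz n => small_scale n end.

Hypothesis nC : nbhs (1%g : G) C.
Hypothesis cC : compact C.
Hypothesis cK : forall n, compact (K n).
Hypothesis rootP : forall A, nbhs (1%g : G) A ->
  [/\ nbhs (1%g : G) (root A), forall x, root A x -> root A (x^-1)%g &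
      cube (root A) `<=` A].
Hypothesis nN : forall n, nbhs (1%g : G) (N n).

Lemma compact_large_scale n : compact (large_scale n).
Proof.
elim: n => [|n IH] /=; first by apply: compactU => //; apply: compact_inv.
apply: compactU; first exact: compact_cube.
by apply: compactU => //; apply: compact_inv.
Qed.

Lemma nbhs_large_scale n : nbhs (1%g : G) (large_scale n).
Proof.
elim: n => [|n IH] /=; first by apply: filterS nC; apply: subsetUl.
apply: filterS (IH) => x Vx; left.
by apply: sub_cube Vx; apply: nbhs_singleton.
Qed.

Lemma large_scaleV n x : large_scale n x -> large_scale n (x^-1)%g.
Proof.
elim: n x => [|n IH] x /=; first exact: setU_invV.
case=> [/(cubeV IH)|/setU_invV]; [by left|by right].
Qed.

Lemma nbhs_small_scale n : nbhs (1%g : G) (small_scale n).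
Proof.
elim: n => [|n IH] /=.
  by have [] := rootP (nbhs_large_scale 0).
have [|//] := rootP (_ : nbhs (1%g : G) (small_scale n `&` N n)).
exact: filterI.
Qed.

Lemma small_scaleV n x : small_scale n x -> small_scale n (x^-1)%g.
Proof.
case: n => [|n] /=; first by have [_ + _] := rootP (nbhs_large_scale 0); apply.
have nI : nbhs (1%g : G) (small_scale n `&` N n).
  by apply: filterI => //; apply: nbhs_small_scale.
by have [_ + _] := rootP nI; apply.
Qed.

Lemma nbhs_full_scale n : nbhs (1%g : G) (full_scale n).
Proof. by case: n => n; [apply: nbhs_large_scale|apply: nbhs_small_scale]. Qed.

Lemma cube_small_scaleS n :
  cube (small_scale n.+1) `<=` small_scale n `&` N n.
Proof.
have nI : nbhs (1%g : G) (small_scale n `&` N n).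
  by apply: filterI => //; apply: nbhs_small_scale.
by have [_ _] := rootP nI.
Qed.

Lemma cube_full_scale n : cube (full_scale n) `<=` full_scale (n + 1).
Proof.
case: n => [n|[|n]].
- by rewrite -PoszD addn1 => x; left.
- by have [_ _] := rootP (nbhs_large_scale 0).
- rewrite (_ : Negz n.+1 + 1 = Negz n); last by lia.
  by move=> x /cube_small_scaleS[].
Qed.

Lemma full_scaleP : scale full_scale.
Proof.
split=> [n|n x|n x y z Ux Uy Uz].
- by apply: nbhs_singleton; apply: nbhs_full_scale.
- by case: n => n; [apply: large_scaleV|apply: small_scaleV].
- by apply: cube_full_scale; exists (x, y, z).
Qed.

Lemma compact_full_scale n : exists2 A, compact A & full_scale n `<=` A.
Proof.
exists (large_scale `|n|%N); first exact: compact_large_scale.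
apply: (scale_mono (n := `|n|%N) full_scaleP); lia.
Qed.

Lemma full_scale_fine n : full_scale (Negz n.+1) `<=` N n.
Proof.
apply: (subset_trans (sub_cube _)); first exact: scale1 full_scaleP _.
by move=> x /cube_small_scaleS[].
Qed.

Lemma full_scale_exhaust n : K n `<=` full_scale n.+1.
Proof. by move=> x Kx; right; left. Qed.

End Existence.

(** The data of the construction are an enumerated countable base, which yields
both the compact sets [K n] and the base [N] at 1, and a choice of cube roots.
Any [K i] that is a neighbourhood of 1 can serve as the initial compact
neighbourhood. *)
Lemma compact_scale_exists (G : topologicalGroupType) :
  locally_compact [set: G] -> @second_countable G ->
  exists U : int -> set G,
    [/\ scale U /\ forall n, nbhs (1%g : G) (U n),
        forall A, nbhs (1%g : G) A -> exists n, U n `<=` A,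
        forall x, exists n, U n x &
        forall n, exists2 A, compact A & U n `<=` A].
Proof.
move=> lcG scG.
have [B Bbase] := countable_base_sequence (1%g : G) scG.
have [K [cK Kcover]] := compact_sequence_cover lcG Bbase.
have [N [nN Nbase]] := nbhs_base_sequence (1%g : G) scG.
have [i nC] := Kcover 1%g.
have /choice[root rootP] : forall A : set G, exists W, nbhs (1%g : G) A ->
    [/\ nbhs (1%g : G) W, forall x, W x -> W (x^-1)%g & cube W `<=` A].
  move=> A; have [/nbhs_cube_root[W WP]|] := pselect (nbhs (1%g : G) A).
    by exists W.
  by exists set0.
exists (full_scale (K i) K root N); split.
- by split; [apply: full_scaleP|apply: nbhs_full_scale].
- move=> A /Nbase[n NA]; exists (Negz n.+1); apply: subset_trans NA.
  exact: full_scale_fine.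
- move=> x; have [n /nbhs_singleton Kx] := Kcover x.
  by exists (Posz n.+1); apply: full_scale_exhaust Kx.
- exact: compact_full_scale.
Qed.

(** * The metric of a scale *)

Definition scale_dist (R : realType) (G : groupType) (U : int -> set G)
  (x y : G) : R := scale_length R U (x^-1 * y)%g.

Lemma scale_dist_is_metric (R : realType) (G : topologicalGroupType)
    (U : int -> set G) :
  hausdorff_space G -> scale U ->
  (forall A, nbhs (1%g : G) A -> exists n, U n `<=` A) ->
  (forall x, exists n, U n x) ->
  is_metric (scale_dist R U).
Proof.
move=> hG sU Ubase Ucover; split => [x|x y d0|x y|y x z].
- by rewrite /scale_dist mulVg scale_length1.
- (* If [x] and [y] are at distance 0, then [x^-1 * y] is in every [U n], so
     every neighbourhood of [x] contains [y]. *)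
  apply: hG => A A' nA nA'; exists y; split; last exact: nbhs_singleton.
  have [n UA] := Ubase _ (nbhs_untranslate nA).
  have /UA : U n (x^-1 * y)%g.
    apply: (scale_length_lt_exp2 (R := R)) => //.
    by rewrite [ltLHS]d0 exp2z_gt0.
  by rewrite /= mulgA mulgV mul1g.
- by rewrite /scale_dist -scale_lengthV// invgM invgK.
- rewrite /scale_dist.
  rewrite -[X in scale_length _ _ X](_ : x^-1 * y * (y^-1 * z) = _)%g.
    exact: scale_lengthM.
  by rewrite mulgA -[(x^-1 * y * y^-1)%g]mulgA mulgV mulg1.
Qed.

Lemma open_metrizedP (R : numFieldType) (T : choiceType) (d : T -> T -> R)
    (dm : is_metric d) (A : set T) :
  open (A : set (metrized dm)) <->
  forall x, A x -> exists2 r, 0 < r & forall y, d x y < r -> A y.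
Proof.
rewrite openE; split=> [Ao x /Ao|Ao x /Ao[r r0 rA]].
  by move=> /nbhs_ballP[r r0 rA]; exists r => // y xy;
    apply: rA; rewrite ballEmdist.
by apply/nbhs_ballP; exists r => // y; rewrite ballEmdist; apply: rA.
Qed.

Theorem theorem4p5 (R : realType) (G : topologicalGroupType)
  (G_hausdorff : hausdorff_space G)
  (G_locally_compact : locally_compact [set: G])
  (G_second_countable : @second_countable G) :
  exists d : G -> G -> R, plig_metric d.
Proof.
have [U [[sU nU] Ubase Ucover Ucompact]] :=
  compact_scale_exists G_locally_compact G_second_countable.
have dm := scale_dist_is_metric R G_hausdorff sU Ubase Ucover.
exists (scale_dist R U); exists dm => [A clA [r Ar]|g x y|A].
- (* A bounded set lies in [x * U n] for any of its points [x] and [n] large. *)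
  have [->|/set0P[x Ax]] := eqVneq A set0; first exact: compact0.
  have [n rn] := exp2z_unbounded r; have [C cC UC] := Ucompact n.
  apply: (subclosed_compact clA (compact_translate (g := x) cC)) => y Ay.
  exists (x^-1 * y)%g; last by rewrite mulgA mulgV mul1g.
  apply/UC/(scale_length_lt_exp2 sU Ucover).
  by apply: le_lt_trans rn; apply: Ar.
- by rewrite /scale_dist invgM mulgA -[(x^-1 * g^-1 * g)%g]mulgA mulVg mulg1.
- rewrite (open_metrizedP dm); split=> [Ao x Ax|Ao].
    have [n UA] := Ubase _ (nbhs_untranslate (open_nbhs_nbhs (conj Ao Ax))).
    exists (2 ^ n) => [|y /(scale_length_lt_exp2 sU Ucover)/UA/=].
      exact: exp2z_gt0.
    by rewrite mulgA mulgV mul1g.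
  rewrite openE => x /Ao[r r0 rA]; have [n nr] := exp2z_small r0.
  apply: filterS (nbhs_translate x (nU n)) => _ [y Uy <-]; apply: rA.
  rewrite /scale_dist mulgA mulVg mul1g; apply: le_lt_trans nr.
  exact: scale_length_le_exp2.
Qed.
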